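(* Let $r>1$, let $H$ be a Hilbert space and let $Q\in\mathbb{B}(H)$ be a non-projection idempotent. Then $Q$ is a universal $r$-idempotent if and only if $I-Q$ is a universal $r$-idempotent.
   Context: $H$ is a non-zero complex Hilbert space, $\mathbb{B}(H)$ the bounded operators on it, $I$ the identity. An idempotent satisfies $Q^2=Q$; a projection is a self-adjoint idempotent; a non-projection idempotent is an idempotent that is not a projection. $C^*\{Q\}$ is the $C^*$-algebra generated by $Q$ alone (not assumed to contain a unit of the ambient algebra). Universal $r$-idempotent ($r>1$): a non-projection idempotent $Q$ in a $C^*$-algebra such that $\|Q\|=r$ and for every non-projection idempotent $Q'$ in any $C^*$-algebra with $\|Q'\|\le r$ there is a $C^*$-algebra homomorphism ($*$-homomorphism) $\pi:C^*\{Q\}\to C^*\{Q'\}$ with $\pi(Q)=Q'$. *)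

(* Defs.v *)
From HB Require Import structures.
From mathcomp Require Import all_boot all_order all_algebra.
From mathcomp Require Import complex ring lra.
From mathcomp Require Import boolp classical_sets functions reals topology.
From mathcomp Require Import normedtype.

Set Implicit Arguments.
Unset Strict Implicit.
Unset Printing Implicit Defensive.

Import Order.TTheory GRing.Theory Num.Theory Num.Def.
Import numFieldNormedType.Exports.

Local Open Scope classical_set_scope.
Local Open Scope complex_scope.
Local Open Scope ring_scope.

(* Norms of normed modules over R[i] take (real) values in R[i]; a real number
   r is compared with them as r%:C. *)

(* The inner product is linear in its first argument. *)
HB.mixin Record CompleteNormedModule_isHilbert (R : realType) H
    & CompleteNormedModule R[i] H := {
  inner : {dot H for (@conjC R[i])} ;
  inner_norm : forall x : H, inner x x = `|x| ^+ 2
}.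

#[short(type="hilbertType")]
HB.structure Definition Hilbert (R : realType) :=
  {H of CompleteNormedModule R[i] H & CompleteNormedModule_isHilbert R H}.

(* C*-algebras are not assumed to be unital, hence the multiplication is not
   taken from the ring hierarchy. *)
HB.mixin Record CompleteNormedModule_isCStarAlgebra (R : realType) A
    & CompleteNormedModule R[i] A := {
  cmul : A -> A -> A ;
  cstar : A -> A ;
  cmulA : associative cmul ;
  cmulDl : left_distributive cmul +%R ;
  cmulDr : right_distributive cmul +%R ;
  cscaleAl : forall (a : R[i]) (x y : A), cmul (a *: x) y = a *: cmul x y ;
  cscaleAr : forall (a : R[i]) (x y : A), cmul x (a *: y) = a *: cmul x y ;
  cstarK : involutive cstar ;
  cstarD : {morph cstar : x y / x + y} ;
  cstarZ : forall (a : R[i]) (x : A), cstar (a *: x) = a^* *: cstar x ;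
  cstarM : forall x y : A, cstar (cmul x y) = cmul (cstar y) (cstar x) ;
  cnormM : forall x y : A, `|cmul x y| <= `|x| * `|y| ;
  cnorm_star_mul : forall x : A, `|cmul (cstar x) x| = `|x| ^+ 2
}.

#[short(type="cstarAlgType")]
HB.structure Definition CStarAlgebra (R : realType) :=
  {A of CompleteNormedModule R[i] A & CompleteNormedModule_isCStarAlgebra R A}.

#[local] Set Warnings "-redundant-canonical-projection".

Section BoundedOperators.
Variables (R : realType) (H : normedModType R[i]).

Definition bounded_op : {pred (H -> H)} := fun f =>
  `[< linear f /\ exists M : R[i], forall x, `|f x| <= M * `|x| >].

Lemma bounded_opP (f : H -> H) : reflect
  (linear f /\ exists M : R[i], forall x, `|f x| <= M * `|x|)
  (f \in bounded_op).
Proof. exact: asboolP. Qed.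

Fact bounded_op_submod_closed : submod_closed bounded_op.
Proof.
split.
  apply/bounded_opP; split; first by move=> a x y; rewrite /= scaler0 addr0.
  by exists 0 => x; rewrite normr0 mul0r.
move=> a f g /bounded_opP[lf [M Mf]] /bounded_opP[lg [N Ng]].
apply/bounded_opP; split.
  move=> b x y; rewrite !fctE lf lg !scalerDr !scalerA (mulrC a b).
  by rewrite addrACA.
exists (`|a| * M + N) => x; rewrite mulrDl (le_trans (ler_normD _ _))//.
by rewrite lerD// normrZ -mulrA ler_wpM2l.
Qed.

HB.instance Definition _ :=
  GRing.isSubmodClosed.Build R[i] (H -> H) bounded_op bounded_op_submod_closed.

Record bop := BOp { bop_fun :> H -> H ; bop_funP : bop_fun \in bounded_op }.

HB.instance Definition _ := [isSub for bop_fun].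
HB.instance Definition _ := [Choice of bop by <:].
HB.instance Definition _ := [SubChoice_isSubLmodule of bop by <:].

Lemma bopP (S T : bop) : (forall x, S x = T x) <-> S = T.
Proof. by split=> [ST|-> //]; apply/val_inj/funext. Qed.

Lemma bop_linear (T : bop) : linear T.
Proof. by case: T => f /= /bounded_opP[]. Qed.
HB.instance Definition _ (T : bop) :=
  GRing.isLinear.Build R[i] H H *:%R T (bop_linear T).

Lemma bop_addE (S T : bop) x : (S + T) x = S x + T x. Proof. by []. Qed.
Lemma bop_oppE (S : bop) x : (- S) x = - S x. Proof. by []. Qed.
Lemma bop_scaleE a (S : bop) x : (a *: S) x = a *: S x. Proof. by []. Qed.
Lemma bop0E x : (0 : bop) x = 0. Proof. by []. Qed.

Lemma norm_realE (V : normedModType R[i]) (x : V) : `|x| = (complex.Re `|x|)%:C.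
Proof. by rewrite RRe_real// normr_real. Qed.

(* The supremum of the norms |T x| over the closed unit ball. *)
Definition opnorm (T : bop) : R[i] :=
  (sup [set complex.Re `|T x| | x in [set x : H | `|x| <= 1]])%:C.

Lemma bop_bounded (T : bop) :
  exists2 M : R[i], 0 <= M & forall x, `|T x| <= M * `|x|.
Proof.
have [_ [M TM]] := bounded_opP _ (bop_funP T).
exists `|M| => // x; have Mx0 := le_trans (normr_ge0 _) (TM x).
by rewrite -[X in _ * X]normr_id -normrM ger0_norm.
Qed.

Lemma opnorm_has_ubound (T : bop) :
  has_ubound [set complex.Re `|T x| | x in [set x : H | `|x| <= 1]].
Proof.
have [M M0 TM] := bop_bounded T; exists (complex.Re M) => _ [x /= x1 <-].
rewrite -lecR -norm_realE RRe_real ?ger0_real//.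
by rewrite (le_trans (TM x))// ler_piMr.
Qed.

Lemma opnorm_ge0 T : 0 <= opnorm T.
Proof.
rewrite ler0c; have <- : complex.Re `|T 0| = 0 :> R by rewrite linear0 normr0.
apply: (ub_le_sup (opnorm_has_ubound T)).
by exists 0 => //=; rewrite normr0.
Qed.

Lemma opnorm_le (T : bop) (M : R[i]) :
  0 <= M -> (forall x, `|T x| <= M * `|x|) -> opnorm T <= M.
Proof.
move=> M0 TM; have Mreal : M = (complex.Re M)%:C by rewrite RRe_real// ger0_real.
rewrite Mreal lecR; apply: ge_sup.
  by exists (complex.Re `|T 0|); exists 0 => //=; rewrite normr0.
move=> _ [x /= x1 <-]; rewrite -lecR -Mreal -norm_realE.
by rewrite (le_trans (TM x))// ler_piMr.
Qed.

Lemma opnormP (T : bop) x : `|T x| <= opnorm T * `|x|.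
Proof.
have [->|x0] := eqVneq x 0; first by rewrite linear0 !normr0 mulr0.
have nx : 0 < `|x| by rewrite normr_gt0.
rewrite -ler_pdivrMr//.
have -> : `|T x| / `|x| = `|T (`|x|^-1 *: x)|.
  by rewrite linearZ normrZ ger0_norm ?invr_ge0// mulrC.
rewrite norm_realE lecR; apply: (ub_le_sup (opnorm_has_ubound T)).
exists (`|x|^-1 *: x) => //=.
by rewrite normrZ ger0_norm ?invr_ge0// mulVf ?gt_eqF.
Qed.

Fact opnormD (S T : bop) : opnorm (S + T) <= opnorm S + opnorm T.
Proof.
apply: opnorm_le => [|x]; first by rewrite addr_ge0// opnorm_ge0.
by rewrite mulrDl (le_trans (ler_normD _ _))// lerD// opnormP.
Qed.

Fact opnormZ (a : R[i]) (T : bop) : opnorm (a *: T) = `|a| * opnorm T.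
Proof.
have le_opnormZ b S : opnorm (b *: S) <= `|b| * opnorm S.
  apply: opnorm_le => [|x]; first by rewrite mulr_ge0// opnorm_ge0.
  by rewrite bop_scaleE normrZ -mulrA ler_wpM2l// opnormP.
apply/eqP; rewrite eq_le le_opnormZ/=.
have [->|a0] := eqVneq a 0; first by rewrite normr0 mul0r opnorm_ge0.
rewrite -ler_pdivlMl ?normr_gt0// -normfV.
by rewrite (le_trans _ (le_opnormZ _ _))// scalerA mulVf// scale1r.
Qed.

Fact opnorm_eq0 (T : bop) : opnorm T = 0 -> T = 0.
Proof.
move=> T0; apply/bopP => x; apply/eqP; rewrite -normr_le0.
by rewrite (le_trans (opnormP _ _))// T0 mul0r.
Qed.

HB.instance Definition _ :=
  Lmodule_isNormed.Build R[i] bop opnormD opnormZ opnorm_eq0.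

Lemma bop_normE (T : bop) : `|T| = opnorm T. Proof. by []. Qed.

Lemma bop_normP (T : bop) x : `|T x| <= `|T| * `|x|.
Proof. exact: opnormP. Qed.

Fact bop_id_subproof : idfun \in bounded_op.
Proof. by apply/bounded_opP; split=> //; exists 1 => x; rewrite mul1r. Qed.
Definition bop_id : bop := BOp bop_id_subproof.

Fact bop_comp_subproof (S T : bop) : S \o T \in bounded_op.
Proof.
apply/bounded_opP; split=> [a x y /=|]; first by rewrite !linearP.
exists (opnorm S * opnorm T) => x /=.
by rewrite (le_trans (opnormP _ _))// -mulrA ler_wpM2l ?opnormP// opnorm_ge0.
Qed.
Definition bop_comp (S T : bop) := BOp (bop_comp_subproof S T).

Fact bop_compA : associative bop_comp.
Proof. by move=> S T U; apply/bopP. Qed.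

Fact bop_compDl : left_distributive bop_comp +%R.
Proof. by move=> S T U; apply/bopP. Qed.

Fact bop_compDr : right_distributive bop_comp +%R.
Proof. by move=> S T U; apply/bopP => x; rewrite /= linearD. Qed.

Fact bop_compZl (a : R[i]) S T : bop_comp (a *: S) T = a *: bop_comp S T.
Proof. exact/bopP. Qed.

Fact bop_compZr (a : R[i]) S T : bop_comp S (a *: T) = a *: bop_comp S T.
Proof. by apply/bopP => x; rewrite /= linearZ. Qed.

Fact bop_norm_comp S T : `|bop_comp S T| <= `|S| * `|T|.
Proof.
apply: opnorm_le => [|x]; first by rewrite mulr_ge0.
rewrite /= (le_trans (opnormP S _))// -mulrA ler_wpM2l ?opnorm_ge0//.
exact: opnormP.
Qed.

End BoundedOperators.

Section Completeness.
Variables (R : realType) (H : completeNormedModType R[i]).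

Fact bop_complete (F : set_system (bop H)) :
  ProperFilter F -> cauchy F -> cvg F.
Proof.
move=> FF /cauchy_ballP cF.
have cFx (e : R[i]) : 0 < e -> \forall p \near (F, F), `|p.1 - p.2| < e :> R[i].
  by move=> e0; have := cF e e0; rewrite -ball_normE.
have cvx (x : H) : cvg ((fun T : bop H => T x) @ F).
  apply: cauchy_cvg; apply/cauchy_ballP => e e0.
  have n0 : 0 < `|x| + 1 by rewrite ltr_wpDl.
  have /cFx : 0 < e / (`|x| + 1) by rewrite divr_gt0.
  rewrite !near_simpl/= => Fe; near=> p => /=.
  rewrite -ball_normE/= -bop_oppE -bop_addE.
  rewrite (le_lt_trans (bop_normP _ _))//.
  rewrite (@le_lt_trans _ _ (`|p.1 - p.2| * (`|x| + 1)))//.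
    by rewrite ler_wpM2l// lerDl.
  by rewrite -ltr_pdivlMr//; near: p.
pose f x := lim ((fun T : bop H => T x) @ F).
have fP x : (fun T : bop H => T x) @ F --> f x by exact: cvx.
have lf : linear f.
  move=> a x y.
  have fxy : (fun T : bop H => T (a *: x + y)) @ F --> a *: f x + f y.
    rewrite (_ : (fun T : bop H => _) =
        (fun T : bop H => a *: T x) \+ (fun T : bop H => T y)); last first.
      by apply/funext => T /=; rewrite linearP.
    exact: cvgD (cvgZl_tmp (fP x)) (fP y).
  exact: (cvg_unique (@norm_hausdorff _ H) (fP _) fxy).
have near_f (e : R[i]) : 0 < e -> \forall T \near F, forall x, `|f x - (T : bop H) x| <= e * `|x|.
  move=> e0; have [[P1 P2] /= [FP1 FP2] Pe] := cFx _ e0.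
  near=> T => x; have PT : P2 T by near: T.
  apply/ler_addgt0Pr => d d0.
  near F => S.
  have PS : P1 S by near: S.
  rewrite -(subrKA (S x)) (le_trans (ler_normD _ _))// addrC lerD//.
    have /= ST := Pe (S, T) (conj PS PT).
    rewrite -bop_oppE -bop_addE (le_trans (bop_normP _ _))//.
    by rewrite ler_wpM2r// ltW.
  by apply: ltW; near: S; exact: cvgr_dist_lt (fP x) _ d0.
have [T1 fT1] : exists T : bop H, forall x, `|f x - T x| <= 1 * `|x|.
  by near F => T; exists T; near: T; exact: near_f.
have fb : f \in @bounded_op R H.
  apply/bounded_opP; split=> //; exists (1 + `|T1|) => x.
  rewrite -[f x](subrK (T1 x)) (le_trans (ler_normD _ _))// mulrDl.
  by rewrite lerD// bop_normP.
apply/cvg_ex; exists (BOp fb); apply/cvgrPdist_le => e e0.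
near=> T; apply: opnorm_le => [|x]; first exact: ltW.
by rewrite bop_addE bop_oppE /=; move: x; near: T; exact: near_f.
Unshelve. all: by end_near. Qed.

HB.instance Definition _ := Uniform_isComplete.Build (bop H) bop_complete.

End Completeness.

Section Adjoint.
Variables (R : realType) (H : hilbertType R).
Implicit Types x y z h : H.

Lemma innerC x y : inner x y = (inner y x)^*.
Proof. by rewrite hermC expr0 mul1r. Qed.

Lemma inner_normD x y :
  `|x + y| ^+ 2 = `|x| ^+ 2 + `|y| ^+ 2 + (inner x y + (inner x y)^*).
Proof. by rewrite -!inner_norm dnormD. Qed.

Lemma inner_normB x y :
  `|x - y| ^+ 2 = `|x| ^+ 2 + `|y| ^+ 2 - (inner x y + (inner x y)^*).
Proof. by rewrite -!inner_norm dnormB. Qed.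

Lemma inner_cauchy_schwarz x y : `|inner x y| <= `|x| * `|y|.
Proof.
have [->|y0] := eqVneq y 0; first by rewrite linear0r !normr0 mulr0.
have N0 : 0 < `|y| ^+ 2 by rewrite exprn_gt0// normr_gt0.
rewrite -(@ler_pXn2r _ 2)// ?nnegrE ?mulr_ge0// exprMn.
set c := inner x y; set N := `|y| ^+ 2 in N0 *.
have NJ : N^* = N by apply: conj_Creal; rewrite gtr0_real.
have dE : inner x ((c / N) *: y) = `|c| ^+ 2 / N.
  by rewrite linearZr_LR /= -/c rmorphM/= fmorphV/= NJ normCK; ring.
have dJ : (`|c| ^+ 2 / N)^* = `|c| ^+ 2 / N.
  by apply: conj_Creal; rewrite ger0_real// divr_ge0 ?exprn_ge0// ltW.
have : 0 <= `|x - (c / N) *: y| ^+ 2 by rewrite exprn_ge0.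
rewrite inner_normB dE dJ normrZ exprMn normrM exprMn normfV (gtr0_norm N0).
rewrite -/N exprVn (_ : _ + _ - _ = `|x| ^+ 2 - `|c| ^+ 2 / N); last first.
  by field; rewrite gt_eqF.
by rewrite subr_ge0 ler_pdivrMr.
Qed.

Lemma inner_inj y z : (forall x, inner x y = inner x z) -> y = z.
Proof.
move=> yz; apply/eqP; rewrite -subr_eq0 -normr_eq0 -sqrf_eq0 -inner_norm.
by rewrite linearBr/= yz subrr.
Qed.

Section Riesz.
Variable phi : H -> R[i].
Hypothesis phi_linear : scalar phi.
Variable M : R[i].
Hypotheses (M0 : 0 <= M) (phiM : forall x, `|phi x| <= M * `|x|).

Let J x := `|x| ^+ 2 - (phi x + (phi x)^*).
Let j x : R := complex.Re (J x).

Let JE x : J x = (j x)%:C.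
Proof.
rewrite RRe_real// rpredB// ?rpredX ?normr_real//.
by apply/CrealP; rewrite rmorphD/= conjCK addrC.
Qed.

Let phiD x y : phi (x + y) = phi x + phi y.
Proof. by have := phi_linear 1 x y; rewrite scale1r mul1r. Qed.

Let phiZ a x : phi (a *: x) = a * phi x.
Proof.
have p0 : phi 0 = 0 by apply/(addrI (phi 0)); rewrite -phiD !addr0.
by have := phi_linear a x 0; rewrite p0 !addr0.
Qed.

Let j_lb : has_lbound (range j).
Proof.
exists (complex.Re (- M ^+ 2)) => _ [x _ <-].
rewrite -lecR -JE RRe_real ?rpredN ?rpredX ?ger0_real// lerNl opprB.
have phi2 : phi x + (phi x)^* <= 2 * (M * `|x|).
  have phiR : phi x + (phi x)^* \is Num.real.
    by apply/CrealP; rewrite rmorphD/= conjCK addrC.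
  rewrite (le_trans (real_ler_norm phiR))// (le_trans (ler_normD _ _))//.
  by rewrite norm_conjC -mulr2n [leRHS]mulr_natl lerMn2r phiM.
rewrite lerBlDr (le_trans phi2)// -subr_ge0.
rewrite (_ : _ - _ = (M - `|x|) ^+ 2); last by ring.
by rewrite real_exprn_even_ge0// rpredB ?normr_real// ger0_real.
Qed.

Let m := inf (range j).

Let m_le x : m <= j x. Proof. by apply: ge_inf => //; exists x. Qed.

Let J_midpoint x y :
  `|x - y| ^+ 2 = 2 * J x + 2 * J y - 4 * J (2^-1 *: (x + y)).
Proof.
rewrite /J normrZ exprMn phiZ phiD inner_normB inner_normD.
rewrite rmorphM rmorphD/= fmorphV/= ger0_norm ?invr_ge0//.
have -> : (2 : R[i])^* = 2 by rewrite rmorph_nat.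
set d := inner x y.
by field.
Qed.

Let J_variation y h (c := inner h y - phi h) :
  `|c| ^+ 2 <= (j y - m)%:C * (`|h| ^+ 2 + 1).
Proof.
set N := `|h| ^+ 2 + 1.
have N0 : 0 < N by rewrite ltr_wpDl// exprn_ge0.
rewrite -ler_pdivrMr//; pose a := - (c^* / N).
have NJ : N^* = N by apply: conj_Creal; rewrite gtr0_real.
have aJ : a^* = - (c / N) by rewrite rmorphN rmorphM/= fmorphV/= conjCK NJ.
have : (m%:C <= J (y + a *: h)) by rewrite JE lecR.
have -> : J (y + a *: h) = J y - `|c| ^+ 2 / N - `|c| ^+ 2 / N ^+ 2.
  rewrite /J inner_normD phiD phiZ normrZ exprMn linearZr_LR/= [inner y h]innerC.
  rewrite !normCK -rmorphM/= conjCK rmorphD/=.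
  rewrite [(a * inner h y)^*]rmorphM [(a * phi h)^*]rmorphM/= aJ.
  have -> : `|h| ^+ 2 = N - 1 by rewrite addrK.
  rewrite /a /c rmorphB/=.
  set p := inner h y; set pJ := p^*; set q := phi h; set qJ := q^*.
  by field; rewrite gt_eqF.
move=> mJ; rewrite raddfB/= -JE lerBrDl addrC -lerBrDl.
rewrite (le_trans mJ)// lerBlDr lerDl.
by rewrite divr_ge0 ?exprn_ge0// ltW.
Qed.

Let F : set_system H :=
  filter_from [set e : R | 0 < e] (fun e => [set x | j x < m + e]).

Let F_proper : ProperFilter F.
Proof.
apply: filter_from_proper; last first.
  move=> e /= e0; have [_ [x _ <-] jx] := inf_adherent e0 (conj (ex_intro _ (j 0) (ex_intro2 _ _ 0 I erefl)) j_lb).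
  by exists x.
apply: filter_from_filter; first by exists 1 => /=.
move=> e d /= e0 d0; exists (Num.min e d) => /=; first by rewrite lt_min e0.
by move=> x /=; rewrite addr_minr lt_min => /andP[].
Qed.

Let posE (e : R[i]) : 0 < e -> 0 < complex.Re e /\ e = (complex.Re e)%:C.
Proof.
by move=> e0; have eE := RRe_real (gtr0_real e0); split; rewrite // -ltcR eE.
Qed.

Let F_cauchy : cauchy F.
Proof.
have FF := F_proper; apply/cauchy_ballP => e /posE[]; set r := complex.Re e => r0 ->.
pose A := [set x | j x < m + r ^+ 2 / 4].
have FA : F A by exists (r ^+ 2 / 4); rewrite //= divr_gt0// exprn_gt0.
exists (A, A) => //= -[x y] [/= Ax Ay].
rewrite -ball_normE/= -(@ltr_pXn2r _ 2)// ?nnegrE// ?ler0c ?ltW//.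
rewrite J_midpoint; set u := 2^-1 *: _.
rewrite !JE -!(rmorph_nat (real_complex R)) -!rmorphM -!rmorphD/=.
rewrite -rmorphB -rmorphXn/= ltcR.
have := m_le u; rewrite /A /= in Ax Ay; move: Ax Ay.
by lra.
Qed.

Lemma riesz : exists z, forall x, phi x = inner x z.
Proof.
have FF := F_proper.
have [z Fz] : exists z : H, F --> z by apply/cvg_ex; exact: cauchy_cvg F_cauchy.
exists z => h; apply/eqP; rewrite eq_sym -subr_eq0 -normr_le0.
apply/ler_addgt0Pr => /= d d0; rewrite add0r.
have [r0 dE] := posE (divr_gt0 d0 (ltr0n _ 2)).
set N := `|h| ^+ 2 + 1.
have N0 : 0 < N by rewrite ltr_wpDl// exprn_ge0.
have [] := posE N0; rewrite -/N; set n := complex.Re N => n0 NE.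
have h0 : 0 < `|h| + 1 by rewrite ltr_wpDl.
have d2 : 0 < d / 2 by rewrite divr_gt0// ltr0n.
have d'0 : 0 < (`|h| + 1)^-1 * (d / 2) by rewrite mulr_gt0// invr_gt0.
near F => y.
rewrite -[z](subrK y) linearDr/= -addrA.
rewrite (le_trans (ler_normD _ _))// (splitr d) lerD//.
  rewrite (le_trans (inner_cauchy_schwarz _ _))//.
  rewrite (@le_trans _ _ ((`|h| + 1) * `|z - y|))//.
    by rewrite ler_wpM2r// lerDl.
  rewrite -ler_pdivlMl//; apply: ltW; near: y.
rewrite -(@ler_pXn2r _ 2)// ?nnegrE ?(ltW d2)//.
apply: (le_trans (J_variation y h)); rewrite -ler_pdivlMr// -/N NE dE -rmorphXn.
rewrite -fmorphV -rmorphM lecR lerBlDl ltW//=.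
near: y; exists (complex.Re (d / 2) ^+ 2 / n) => //=.
by rewrite divr_gt0// exprn_gt0.
Unshelve. all: by end_near. Qed.

End Riesz.

Fact bop_adj_subproof (T : bop H) :
  exists f : H -> H, forall x y, inner (T x) y = inner x (f y).
Proof.
suff zP y : exists z, forall x, inner (T x) y = inner x z.
  by have /choice[f fP] := zP; exists f => x y; exact: fP.
apply: (@riesz (fun x => inner (T x) y) _ (`|T| * `|y|)) => [a x z||x].
- by rewrite linearP linearDl linearZl_LR.
- by rewrite mulr_ge0.
rewrite (le_trans (inner_cauchy_schwarz _ _))// mulrAC ler_wpM2r//.
exact: bop_normP.
Qed.

Definition bop_adj_fun (T : bop H) : H -> H := sval (cid (bop_adj_subproof T)).

Fact bop_adj_funP (T : bop H) x y : inner (T x) y = inner x (bop_adj_fun T y).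
Proof. by rewrite /bop_adj_fun; case: cid => /= f ->. Qed.

Fact bop_adj_fun_le (T : bop H) y : `|bop_adj_fun T y| <= `|T| * `|y|.
Proof.
set z := bop_adj_fun T y; have [->|z0] := eqVneq z 0.
  by rewrite normr0 mulr_ge0.
have nz : 0 < `|z| by rewrite normr_gt0.
rewrite -(ler_pM2r nz) -expr2 -inner_norm -bop_adj_funP.
rewrite -[X in X <= _]ger0_norm; last by rewrite bop_adj_funP inner_norm exprn_ge0.
rewrite (le_trans (inner_cauchy_schwarz _ _))// mulrAC ler_wpM2r//.
exact: bop_normP.
Qed.

Fact bop_adj_bounded (T : bop H) : bop_adj_fun T \in @bounded_op R H.
Proof.
apply/bounded_opP; split; last by exists `|T|; exact: bop_adj_fun_le.
move=> a y z; apply: inner_inj => x.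
by rewrite linearDr linearZr_LR/= -!bop_adj_funP linearDr linearZr_LR.
Qed.

Definition bop_adj (T : bop H) : bop H := BOp (bop_adj_bounded T).

Lemma bop_adjP (T : bop H) x y : inner (T x) y = inner x (bop_adj T y).
Proof. exact: bop_adj_funP. Qed.

Lemma bop_adjP' (T : bop H) x y : inner (bop_adj T x) y = inner x (T y).
Proof. by rewrite innerC -bop_adjP -innerC. Qed.

Fact bop_adjK : involutive bop_adj.
Proof.
move=> T; apply/bopP => y; apply: inner_inj => x.
by rewrite -bop_adjP bop_adjP'.
Qed.

Fact bop_adjD : {morph bop_adj : S T / S + T}.
Proof.
move=> S T; apply/bopP => y; apply: inner_inj => x.
by rewrite -bop_adjP !bop_addE linearDl linearDr/= !bop_adjP.
Qed.

Fact bop_adjZ (a : R[i]) (T : bop H) : bop_adj (a *: T) = a^* *: bop_adj T.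
Proof.
apply/bopP => y; apply: inner_inj => x.
by rewrite -bop_adjP !bop_scaleE linearZl_LR linearZr_LR/= conjCK bop_adjP.
Qed.

Fact bop_adjM (S T : bop H) :
  bop_adj (bop_comp S T) = bop_comp (bop_adj T) (bop_adj S).
Proof.
by apply/bopP => y; apply: inner_inj => x; rewrite -bop_adjP /= !bop_adjP.
Qed.

Fact bop_norm_adj (T : bop H) : `|bop_comp (bop_adj T) T| = `|T| ^+ 2.
Proof.
have adj_le (S : bop H) : `|bop_adj S| <= `|S|.
  by apply: opnorm_le => // x; exact: bop_adj_fun_le.
apply/eqP; rewrite eq_le; apply/andP; split.
  by rewrite (le_trans (bop_norm_comp _ _))// expr2 ler_wpM2r.
set N := `|bop_comp _ _|.
have N0 : 0 <= N by rewrite normr_ge0.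
suff : `|T| <= sqrtC N.
  by rewrite -(@ler_pXn2r _ 2)// ?nnegrE ?sqrtC_ge0// sqrtCK.
apply: opnorm_le => [|x]; first by rewrite sqrtC_ge0.
rewrite -(@ler_pXn2r _ 2)// ?nnegrE ?mulr_ge0 ?sqrtC_ge0//.
rewrite exprMn sqrtCK -inner_norm -bop_adjP'.
rewrite -[X in X <= _]ger0_norm; last by rewrite bop_adjP' inner_norm exprn_ge0.
rewrite (le_trans (inner_cauchy_schwarz _ _))// expr2 mulrA ler_wpM2r//.
exact: (bop_normP (bop_comp (bop_adj T) T)).
Qed.

HB.instance Definition _ :=
  CompleteNormedModule_isCStarAlgebra.Build R (bop H)
    (@bop_compA R H) (@bop_compDl R H) (@bop_compDr R H)
    (@bop_compZl R H) (@bop_compZr R H)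
    bop_adjK bop_adjD bop_adjZ bop_adjM (@bop_norm_comp R H) bop_norm_adj.

End Adjoint.

Section Universal.
Variable R : realType.

Definition is_idempotent (A : cstarAlgType R) (Q : A) := cmul Q Q = Q.

Definition is_projection (A : cstarAlgType R) (Q : A) :=
  is_idempotent Q /\ cstar Q = Q.

Definition nonproj_idempotent (A : cstarAlgType R) (Q : A) :=
  is_idempotent Q /\ ~ is_projection Q.

Definition cstar_subalgebra (A : cstarAlgType R) (S : set A) :=
  [/\ closed S,
      S 0 /\ (forall (a : R[i]) x y, S x -> S y -> S (a *: x + y)),
      forall x y, S x -> S y -> S (cmul x y) &
      forall x, S x -> S (cstar x)].

(* The C*-algebra generated by Q alone: the unit of A, if any, need not belong
   to it. *)
Definition cstar_gen (A : cstarAlgType R) (Q : A) : set A :=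
  smallest (@cstar_subalgebra A) [set Q].

Lemma cstar_gen_subalgebra (A : cstarAlgType R) (Q : A) :
  cstar_subalgebra (cstar_gen Q).
Proof.
split=> [|||].
- by apply: closed_bigI => S [[]].
- split=> [S [[_ [S0 _] _ _] _]//|a x y Gx Gy S SP].
  by have [[_ [_ SL] _ _] _] := SP; apply: SL; [exact: Gx|exact: Gy].
- move=> x y Gx Gy S SP.
  by have [[_ _ SM _] _] := SP; apply: SM; [exact: Gx|exact: Gy].
- by move=> x Gx S SP; have [[_ _ _ SJ] _] := SP; apply: SJ; exact: Gx.
Qed.

Lemma cstar_gen_self (A : cstarAlgType R) (Q : A) : cstar_gen Q Q.
Proof. by move=> S [_]; apply. Qed.

(* A map between the subsets S and S' is represented by a total function, of
   which only the values on S matter. *)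
Definition star_homomorphism (A B : cstarAlgType R) (S : set A) (S' : set B)
    (pi : A -> B) :=
  [/\ forall x, S x -> S' (pi x),
      forall (a : R[i]) x y, S x -> S y -> pi (a *: x + y) = a *: pi x + pi y,
      forall x y, S x -> S y -> pi (cmul x y) = cmul (pi x) (pi y) &
      forall x, S x -> pi (cstar x) = cstar (pi x)].

Definition universal_idempotent (r : R) (A : cstarAlgType R) (Q : A) :=
  [/\ nonproj_idempotent Q,
      `|Q| = r%:C &
      forall (B : cstarAlgType R) (Q' : B),
        nonproj_idempotent Q' -> `|Q'| <= r%:C ->
        exists pi : A -> B,
          star_homomorphism (cstar_gen Q) (cstar_gen Q') pi /\ pi Q = Q'].

End Universal.

(* Main.v *)
(* Let Q be universal. Since |I - Q| = |Q|, universality provides a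
   *-homomorphism C*{Q} -> C*{I - Q} sending Q to I - Q. If I is not in C*{Q}, it
   extends unitally to C*{Q} + C I, and the extension sends I - Q to Q. As
   *-homomorphisms are bounded, the extension maps C*{I - Q} into C*{Q};
   composing it with the homomorphisms C*{Q} -> C*{Q'} shows that I - Q is
   universal.

   To see that I is not in C*{Q}, take orthonormal u, v and the idempotents
   Q_n = <-, u + s_n v> u with s_n > 0 tending to 0, and pi_n : C*{Q} -> C*{Q_n}
   with pi_n Q = Q_n. The x such that pi_n x v and pi_n (x^* ) v tend to 0 form a
   C*-algebra containing Q, but pi_n I is a unit for Q_n, so it fixes v. *)
Require Import Defs.
From mathcomp Require Import all_boot all_order all_algebra.
From mathcomp Require Import boolp classical_sets reals topology normedtype.
From mathcomp Require Import complex ring lra.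

Set Implicit Arguments.
Unset Strict Implicit.
Unset Printing Implicit Defensive.

Import Order.TTheory GRing.Theory Num.Theory Num.Def.
Import numFieldNormedType.Exports.

Local Open Scope classical_set_scope.
Local Open Scope complex_scope.
Local Open Scope ring_scope.

(** * Real-valued norms, closedness, and limits in complete normed modules *)

Lemma Re_normr_ge0 (R : rcfType) (a : R[i]) : 0 <= complex.Re `|a|.
Proof. by rewrite -ler0c RRe_real ?normr_real. Qed.

(* The norm of an [R[i]]-module takes values in [R[i]], which is only partially
   ordered; this is the same norm with values in [R]. *)
Definition rnorm (R : realType) (V : normedModType R[i]) (x : V) : R :=
  complex.Re `|x|.

Section RealNorm.
Variables (R : realType) (V : normedModType R[i]).
Implicit Types (x y : V) (a : R[i]).

Lemma rnormE x : `|x| = (rnorm x)%:C. Proof. exact: norm_realE. Qed.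

Lemma rnorm_ge0 x : 0 <= rnorm x.
Proof. by rewrite -ler0c -rnormE. Qed.

Lemma rnorm0 : rnorm (0 : V) = 0. Proof. by rewrite /rnorm normr0. Qed.

Lemma rnorm_eq0 x : (rnorm x == 0) = (x == 0).
Proof. by rewrite -(normr_eq0 x) rnormE -[0 in RHS]/(0%:C) (inj_eq (@complexI R)). Qed.

Lemma rnormN x : rnorm (- x) = rnorm x.
Proof. by rewrite /rnorm normrN. Qed.

Lemma rnormB x y : rnorm (x - y) = rnorm (y - x).
Proof. by rewrite /rnorm distrC. Qed.

Lemma ler_rnormD x y : rnorm (x + y) <= rnorm x + rnorm y.
Proof. by rewrite -lecR rmorphD/= -!rnormE ler_normD. Qed.

Lemma ler_rnormB x y : rnorm (x - y) <= rnorm x + rnorm y.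
Proof. by rewrite -(rnormN y) ler_rnormD. Qed.

Lemma ler_rdist x y z : rnorm (x - z) <= rnorm (x - y) + rnorm (y - z).
Proof. by rewrite (_ : x - z = (x - y) + (y - z)) ?ler_rnormD// subrKA. Qed.

Lemma rnormZ a x : rnorm (a *: x) = complex.Re `|a| * rnorm x.
Proof.
by apply: complexI; rewrite rmorphM/= -!rnormE normrZ.
Qed.

Lemma rnormZR (r : R) x : 0 <= r -> rnorm (r%:C *: x) = r * rnorm x.
Proof. by move=> r0; rewrite rnormZ ger0_norm// ler0c. Qed.

(** Later closedness proofs go through this form, which replaces neighbourhoods by real
    tolerances. *)
Lemma closed_approxP (S : set V) : closed S <->
  forall x, (forall e : R, 0 < e -> exists2 y, S y & rnorm (x - y) <= e) -> S x.
Proof.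
split=> [clS x Sx|Sx x clx].
  apply: clS => B /nbhs_ballP[e /= e0 eB].
  have r0 : 0 < complex.Re e by rewrite -ltcR RRe_real ?gtr0_real.
  have [|y Sy xy] := Sx (complex.Re e / 2); first by rewrite divr_gt0.
  exists y; split=> //; apply: eB; rewrite -ball_normE/= rnormE.
  rewrite -[e]RRe_real ?gtr0_real// ltcR; lra.
apply: Sx => e e0.
have [|y [Sy xy]] := clx (ball x e%:C).
  by apply: nbhsx_ballx; rewrite ltcR.
by exists y => //; move: xy; rewrite -ball_normE/= rnormE ltcR => /ltW.
Qed.

End RealNorm.

(* Cantor's intersection theorem, for sets that need not be closed. *)
Lemma shrinking_sets_limit (R : realType) (V : completeNormedModType R[i])
    (P : R -> set V) (C : R) :
    (forall e, 0 < e -> P e !=set0) ->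
    (forall d e, d <= e -> P d `<=` P e) ->
    (forall e x y, 0 < e -> P e x -> P e y -> rnorm (x - y) <= C * e) ->
  exists z, forall e, 0 < e -> exists2 x, P e x & rnorm (z - x) <= e.
Proof.
move=> P0 Pmono Pdiam.
pose F : set_system V := filter_from [set e : R | 0 < e] P.
have FF : ProperFilter F.
  apply: filter_from_proper; last by move=> e /P0.
  apply: filter_from_filter; first by exists 1 => /=.
  move=> d e /= d0 e0; exists (Num.min d e) => /=; first by rewrite lt_min d0.
  by move=> x Px; split; apply: Pmono Px; rewrite ge_min lexx ?orbT.
have [z Fz] : exists z : V, F --> z.
  apply/cvg_ex; apply: cauchy_cvg; apply/cauchy_ballP => e e0.
  have r0 : 0 < complex.Re e by rewrite -ltcR RRe_real ?gtr0_real.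
  (* [C] may have any sign; the divisor [|C| + 1] is positive and exceeds [C], so [C * d] stays
     below the real part of [e]. *)
  pose d := complex.Re e / (`|C| + 1).
  have C1 : 0 < `|C| + 1 by rewrite ltr_wpDl.
  have d0 : 0 < d by rewrite divr_gt0.
  have FP : F (P d) by exists d.
  exists (P d, P d) => //= -[x y] [/= Px Py].
  rewrite -ball_normE/= rnormE -[e]RRe_real ?gtr0_real// ltcR.
  apply: (le_lt_trans (Pdiam _ _ _ d0 Px Py)).
  rewrite -[ltRHS](divfK (lt0r_neq0 C1)) -/d mulrC ltr_pM2l//.
  by rewrite (le_lt_trans (ler_norm C))// ltrDl.
exists z => e e0.
have Fe : F (P e) by exists e.
have Fb : F (ball z e%:C) by apply: Fz; apply: nbhsx_ballx; rewrite ltcR.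
have [x [Px]] := filter_ex (filterI Fe Fb).
by rewrite -ball_normE/= rnormE ltcR => /ltW; exists x.
Qed.

(** Banach's fixed point theorem. The points moved by at most [e] form nested sets. Iteration shows
    them nonempty, and two such points satisfy [|x - y| <= 2 e + |x - y| / 2], so the diameter is at
    most [4 e]. *)
Lemma half_lipschitz_fixpoint (R : realType) (V : completeNormedModType R[i])
    (U : set V) (f : V -> V) :
    closed U -> U !=set0 -> (forall x, U x -> U (f x)) ->
    (forall x y, U x -> U y -> 2 * rnorm (f x - f y) <= rnorm (x - y)) ->
  exists2 x, U x & f x = x.
Proof.
move=> clU [x0 Ux0] Uf flip.
pose P e := [set x | U x /\ rnorm (f x - x) <= e].
have [|||z Pz] := @shrinking_sets_limit R V P 4.
- move=> e e0; pose x n := iter n f x0.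
  have Ux n : U (x n) by elim: n => //= n; exact: Uf.
  have xn n : 2 ^+ n * rnorm (f (x n) - x n) <= rnorm (f x0 - x0).
    elim: n => [|n]; first by rewrite mul1r.
    apply: le_trans; rewrite exprSr -mulrA ler_wpM2l ?exprn_ge0//=.
    exact: (flip (f (x n)) (x n) (Uf _ (Ux n)) (Ux n)).
  have D0 := rnorm_ge0 (f x0 - x0); set D := rnorm _ in xn D0.
  (* The n-th iterate is moved by at most [D / 2 ^ n], and [D / e < n <= 2 ^ n]. *)
  pose n := (Num.bound (D / e)).
  exists (x n); split => //.
  have De : D / e < n%:R.
    by rewrite archi_boundP// divr_ge0// ltW.
  have n2 : (n%:R : R) <= 2 ^+ n by rewrite -natrX ler_nat ltnW// ltn_expl.
  have := lt_le_trans De n2; rewrite ltr_pdivrMr// => Den.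
  have p0 : (0 : R) < 2 ^+ n by rewrite exprn_gt0.
  have := le_lt_trans (xn n) Den; rewrite ltr_pM2l// => /ltW; exact.
- by move=> d e de x [Ux fx]; split=> //; exact: le_trans de.
- move=> e x y e0 [Ux fx] [Uy fy].
  have := ler_rdist x (f x) y; have := ler_rdist (f x) (f y) y.
  have := flip _ _ Ux Uy; rewrite (rnormB x (f x)); lra.
have Uz : U z.
  by apply: ((closed_approxP U).1 clU) => e /Pz[x [Ux _] zx]; exists x.
exists z => //; apply/eqP; rewrite -subr_eq0 -rnorm_eq0 eq_le rnorm_ge0 andbT.
apply/ler_addgt0Pr => e e0; rewrite add0r.
have [|x [Ux fx] zx] := Pz (e / 4); first by rewrite divr_gt0.
have := ler_rdist (f z) (f x) z; have := ler_rdist (f x) x z.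
have := flip _ _ Uz Ux; rewrite (rnormB x z); lra.
Qed.

Lemma rnorm_arbitrarily_small (R : realType) (V : normedModType R[i]) (C : R)
  (x : V) : (forall e, 0 < e -> rnorm x <= C * e) -> x = 0.
Proof.
move=> xC; apply/eqP; rewrite -rnorm_eq0 eq_le rnorm_ge0 andbT.
have C1 : 0 < `|C| + 1 by rewrite ltr_wpDl.
apply/ler_addgt0Pr => e e0; rewrite add0r.
apply: (le_trans (xC (e / (`|C| + 1)) _)); first by rewrite divr_gt0.
rewrite mulrCA ger_pMr// ler_pdivrMr// mul1r (le_trans (ler_norm C))//.
by rewrite lerDl.
Qed.

(** * Non-unital C*-algebras and their C*-subalgebras *)

Section CStarAlgebraTheory.
Variables (R : realType) (A : cstarAlgType R).
Implicit Types (x y : A) (a : R[i]) (S : set A).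

Lemma cmulNl x y : cmul (- x) y = - cmul x y.
Proof. by rewrite -scaleN1r cscaleAl scaleN1r. Qed.

Lemma cmulNr x y : cmul x (- y) = - cmul x y.
Proof. by rewrite -scaleN1r cscaleAr scaleN1r. Qed.

Lemma cmulBl x y z : cmul (x - y) z = cmul x z - cmul y z.
Proof. by rewrite cmulDl cmulNl. Qed.

Lemma cmulBr x y z : cmul x (y - z) = cmul x y - cmul x z.
Proof. by rewrite cmulDr cmulNr. Qed.

Lemma cstarN x : cstar (- x) = - cstar x.
Proof. by rewrite -scaleN1r cstarZ rmorphN1 scaleN1r. Qed.

Lemma cstarB x y : cstar (x - y) = cstar x - cstar y.
Proof. by rewrite cstarD cstarN. Qed.

Lemma ler_rnormM x y : rnorm (cmul x y) <= rnorm x * rnorm y.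
Proof. by rewrite -lecR rmorphM/= -!rnormE cnormM. Qed.

Lemma rnorm_star_mul x : rnorm (cmul (cstar x) x) = rnorm x ^+ 2.
Proof. by apply: complexI; rewrite rmorphXn/= -!rnormE cnorm_star_mul. Qed.

(** The C*-identity gives [|y| ^ 2 <= |cstar y| |y|]. Cancel [|y|], then apply the result to
    [cstar x] as well. *)
Lemma rnorm_star x : rnorm (cstar x) = rnorm x.
Proof.
suff le_star y : rnorm y <= rnorm (cstar y).
  by apply/eqP; rewrite eq_le le_star -{2}[x]cstarK le_star.
have [->|y0] := eqVneq y 0; first by rewrite rnorm0 rnorm_ge0.
have ny0 : 0 < rnorm y by rewrite lt_def rnorm_eq0 y0 rnorm_ge0.
by rewrite -(ler_pM2r ny0) -expr2 -rnorm_star_mul ler_rnormM.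
Qed.

Section Subalgebra.
Variables (S : set A) (subS : cstar_subalgebra S).

Lemma subalg0 : S 0. Proof. by have [_ []] := subS. Qed.

Lemma subalgP a x y : S x -> S y -> S (a *: x + y).
Proof. by have [_ [_ +] _ _] := subS; apply. Qed.

Lemma subalgD x y : S x -> S y -> S (x + y).
Proof. by rewrite -[x in S (x + _)]scale1r; exact: subalgP. Qed.

Lemma subalgZ a x : S x -> S (a *: x).
Proof. by move=> Sx; rewrite -[_ *: _]addr0; apply: subalgP subalg0. Qed.

Lemma subalgB x y : S x -> S y -> S (x - y).
Proof. by move=> Sx Sy; rewrite addrC -scaleN1r; exact: subalgP. Qed.

Lemma subalgM x y : S x -> S y -> S (cmul x y).
Proof. by have [_ _ + _] := subS; apply. Qed.

Lemma subalg_star x : S x -> S (cstar x).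
Proof. by have [_ _ _ +] := subS; apply. Qed.

Lemma subalg_limit x :
  (forall e : R, 0 < e -> exists2 y, S y & rnorm (x - y) <= e) -> S x.
Proof. by have [clS _ _ _] := subS; apply: (closed_approxP S).1. Qed.

End Subalgebra.

(** The induction principle for generated algebras: a property that cuts out a C*-subalgebra and
    holds at [Q] holds throughout. *)
Lemma cstar_gen_subset (Q : A) S :
  cstar_subalgebra S -> S Q -> cstar_gen Q `<=` S.
Proof. by move=> subS SQ; apply: smallest_sub => // _ ->. Qed.

(** Each condition survives limits, since replacing [x] by an approximant costs a multiple of the
    tolerance. This makes the domain of the fixed point map below closed. *)
Lemma selfadjoint_commuting_closed (h : A) (r : R) :
  closed [set y | [/\ cstar y = y, cmul y h = cmul h y & rnorm y <= r]].
Proof.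
apply/closed_approxP => x xlim; split.
- apply/eqP; rewrite -subr_eq0; apply/eqP.
  apply: (@rnorm_arbitrarily_small _ _ 2) => e /xlim[y [sy _ _] xy].
  rewrite (_ : cstar x - x = cstar (x - y) - (x - y)).
    by have := ler_rnormB (cstar (x - y)) (x - y); rewrite rnorm_star; lra.
  by rewrite cstarB sy opprB addrA subrK.
- apply/eqP; rewrite -subr_eq0; apply/eqP.
  apply: (@rnorm_arbitrarily_small _ _ (2 * rnorm h)) => e /xlim[y [_ cy _] xy].
  rewrite (_ : cmul x h - _ = cmul (x - y) h - cmul h (x - y)); last first.
    by rewrite cmulBl cmulBr cy opprB addrA subrK.
  have := ler_rnormB (cmul (x - y) h) (cmul h (x - y)).
  have := ler_rnormM (x - y) h; have := ler_rnormM h (x - y).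
  have : rnorm (x - y) * rnorm h <= e * rnorm h by rewrite ler_wpM2r ?rnorm_ge0.
  lra.
- apply/ler_addgt0Pr => e /xlim[y [_ _ yr] xy].
  by have := ler_rnormD (x - y) y; rewrite subrK; lra.
Qed.

(* In a unital algebra [1 - y] is a square root of [1 - h ^ 2]. *)
Lemma selfadjoint_quasi_sqrt S (h : A) :
    cstar_subalgebra S -> S h -> cstar h = h -> 2 * rnorm h <= 1 ->
  exists y, [/\ S y, cstar y = y, cmul y h = cmul h y &
                cmul h h + cmul y y = y + y].
Proof.
move=> subS Sh sh h1.
pose f y : A := (2^-1)%:C *: (cmul h h + cmul y y).
(* The radius [1/2] serves two purposes: [|h|, |y| <= 1/2] give [|f y| <= 1/4], and the Lipschitz
   constant of [f] is at most [(|x| + |y|) / 2 <= 1/2]. *)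
pose U := S `&` [set y | [/\ cstar y = y, cmul y h = cmul h y & rnorm y <= 2^-1]].
have half0 : 0 <= 2^-1 :> R by rewrite invr_ge0.
have [||||y [Sy [sy cy _]] fy] := @half_lipschitz_fixpoint _ _ U f.
- by apply: closedI; [case: subS|exact: selfadjoint_commuting_closed].
- exists 0; split; first exact: subalg0.
  split; rewrite ?rnorm0//.
    by rewrite -(scale0r (0 : A)) cstarZ rmorph0 !scale0r.
  by rewrite -(scale0r (0 : A)) cscaleAl cscaleAr !scale0r.
- move=> y [Sy [sy cy y1]]; split.
    by apply: subalgZ; rewrite //; apply: subalgD => //; exact: subalgM.
  split.
  + rewrite cstarZ cstarD !cstarM sh sy; congr (_ *: _).
    by rewrite conj_Creal// realE ler0c half0.
  + by rewrite cscaleAl cscaleAr cmulDl cmulDr -!cmulA cy !cmulA cy.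
  + rewrite rnormZR//.
    have := ler_rnormD (cmul h h) (cmul y y).
    have := ler_rnormM h h; have := ler_rnormM y y.
    have := rnorm_ge0 h; have := rnorm_ge0 y; nra.
- move=> x y [_ [_ _ x1]] [_ [_ _ y1]].
  rewrite /f -scalerBr rnormZR//.
  (* This splitting of [x ^ 2 - y ^ 2] is valid although [x] and [y] may fail to commute. *)
  rewrite (_ : _ - _ = cmul x (x - y) + cmul (x - y) y); last first.
    by rewrite cmulBl cmulBr opprD addrACA subrr add0r addrA subrK.
  have := ler_rnormD (cmul x (x - y)) (cmul (x - y) y).
  have := ler_rnormM x (x - y); have := ler_rnormM (x - y) y.
  have := rnorm_ge0 (x - y); nra.
exists y; split=> //; transitivity (f y + f y); last by rewrite fy.
by rewrite -scalerDl -rmorphD/= -[X in X + X]mul1r -splitr scale1r.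
Qed.

(** In a unital algebra the hypothesis says that [1 - v] is an isometry. The C*-identity turns it
    into [|v| ^ 2 <= 2 |v|]. *)
Lemma rnorm_quasi_unitary (v : A) :
  cmul (cstar v) v = cstar v + v -> rnorm v <= 2.
Proof.
move=> vv; have := ler_rnormD (cstar v) v.
rewrite -vv rnorm_star_mul rnorm_star; have := rnorm_ge0 v; nra.
Qed.

End CStarAlgebraTheory.

(** * Boundedness of star homomorphisms *)

Section StarHomomorphism.
Variables (R : realType) (A B : cstarAlgType R) (S : set A) (S' : set B).
Variable pi : A -> B.
Hypotheses (subS : cstar_subalgebra S) (hom_pi : star_homomorphism S S' pi).

Lemma star_hom0 : pi 0 = 0.
Proof.
have [_ piP _ _] := hom_pi; have S0 := subalg0 subS.
by have := piP (-1) _ _ S0 S0; rewrite !scaleN1r !addNr.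
Qed.

Lemma star_homD x y : S x -> S y -> pi (x + y) = pi x + pi y.
Proof.
by move=> Sx Sy; have [_ /(_ 1 _ _ Sx Sy)] := hom_pi; rewrite !scale1r.
Qed.

Lemma star_homZ a x : S x -> pi (a *: x) = a *: pi x.
Proof.
move=> Sx; have [_ /(_ a _ _ Sx (subalg0 subS))] := hom_pi.
by rewrite star_hom0 !addr0.
Qed.

Lemma star_homB x y : S x -> S y -> pi (x - y) = pi x - pi y.
Proof.
move=> Sx Sy; have [_ piP _ _] := hom_pi.
by rewrite addrC -scaleN1r piP// scaleN1r addrC.
Qed.

(* The quasi-square root y of [1 - h ^ 2] makes [1 - pi y - i pi h] unitary. *)
Lemma star_hom_selfadjoint_bounded h :
  S h -> cstar h = h -> 2 * rnorm h <= 1 -> rnorm (pi h) <= 2.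
Proof.
move=> Sh sh h1.
have [y [Sy sy cy hy]] := selfadjoint_quasi_sqrt subS Sh sh h1.
have [_ _ piM piS] := hom_pi.
have spih : cstar (pi h) = pi h by rewrite -piS ?sh.
have spiy : cstar (pi y) = pi y by rewrite -piS ?sy.
have pihy : cmul (pi y) (pi h) = cmul (pi h) (pi y) by rewrite -!piM// cy.
have piyy : cmul (pi h) (pi h) + cmul (pi y) (pi y) = pi y + pi y.
  by rewrite -!piM// -!star_homD ?hy//; exact: subalgM.
pose v := pi y + 'i *: pi h.
have sv : cstar v = pi y - 'i *: pi h.
  by rewrite cstarD cstarZ spih spiy conjCi scaleNr.
have v2 : rnorm v <= 2.
  apply: rnorm_quasi_unitary; rewrite sv /v.
  rewrite cmulBl !cmulDr !cscaleAl !cscaleAr scalerA -expr2 sqrCi scaleN1r pihy.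
  rewrite opprD opprK addrA addrK (addrC (cmul _ _)) piyy.
  by rewrite [RHS]addrACA addNr addr0.
have := ler_rnormB v (cstar v); rewrite rnorm_star.
(* This difference has norm at most [4], whence the bound [2] for [pi h]. *)
have -> : v - cstar v = (2 * 'i) *: pi h.
  by rewrite sv /v opprB addrC addrA subrK -scalerDl -mulr2n mulr_natl.
rewrite rnormZ normrM normCi mulr1 normr_nat.
by rewrite -(rmorph_nat (real_complex R)) /= => vv; lra.
Qed.

(** Scaling [cmul (cstar x) x] to norm [1/2] reduces to the self-adjoint case, and the C*-identity
    gives [|pi x| ^ 2 <= 4 |x| ^ 2]. The constant is independent of [pi], so it serves a whole
    sequence of homomorphisms at once. *)
Lemma star_hom_bounded x : S x -> rnorm (pi x) <= 2 * rnorm x.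
Proof.
move=> Sx; have [_ _ piM piS] := hom_pi.
have [->|x0] := eqVneq x 0; first by rewrite star_hom0 !rnorm0 mulr0.
have nx0 : 0 < rnorm x by rewrite lt_def rnorm_eq0 x0 rnorm_ge0.
pose h := cmul (cstar x) x; pose c := (2 * rnorm x ^+ 2)^-1.
have c0 : 0 < c by rewrite invr_gt0 mulr_gt0// exprn_gt0.
have Sh : S h by apply: subalgM => //; exact: subalg_star.
have Sch : S (c%:C *: h) by exact: subalgZ.
have := star_hom_selfadjoint_bounded Sch.
rewrite star_homZ// /h piM ?piS//; last exact: subalg_star.
rewrite !(rnormZR _ (ltW c0)) !rnorm_star_mul cstarZ cstarM cstarK.
rewrite conj_Creal ?realE ?ler0c ?(ltW c0)// => /(_ erefl).
have -> : 2 * (c * rnorm x ^+ 2) = 1 by rewrite /c; field; rewrite lt0r_neq0.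
move=> /(_ (lexx _)).
rewrite /c mulrC ler_pdivrMr ?mulr_gt0 ?exprn_gt0// => pix.
rewrite -(@ler_pXn2r _ 2)// ?nnegrE ?mulr_ge0 ?rnorm_ge0// exprMn.
lra.
Qed.

End StarHomomorphism.

(** * Idempotents on a Hilbert space and their complements *)

Section HilbertOperators.
Variables (R : realType) (H : hilbertType R).
Implicit Types (x y u v : H) (T Q : bop H).

Local Notation I := (bop_id H).

Lemma ler_rnorm_bop T x : rnorm (T x) <= rnorm T * rnorm x.
Proof. by rewrite -lecR rmorphM/= -!rnormE bop_normP. Qed.

Lemma rnorm_bop_le T (M : R) :
  0 <= M -> (forall x, rnorm (T x) <= M * rnorm x) -> rnorm T <= M.
Proof.
move=> M0 TM; rewrite -lecR -rnormE; apply: opnorm_le => [|x].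
  by rewrite ler0c.
by rewrite !rnormE -rmorphM lecR.
Qed.

Lemma rnorm_sqr x : ((rnorm x) ^+ 2)%:C = inner x x.
Proof. by rewrite rmorphXn/= -rnormE inner_norm. Qed.

Lemma rnormD_sqr x y : rnorm (x + y) ^+ 2 =
  rnorm x ^+ 2 + rnorm y ^+ 2 + 2 * complex.Re (inner x y).
Proof.
apply: complexI; rewrite !rmorphD !rmorphXn/= -!rnormE inner_normD.
congr (_ + _); case: (inner x y) => a b /=.
by simpc; rewrite mulr_natl mulr2n.
Qed.

Lemma cstar_id : cstar I = I.
Proof. by apply/bopP => x; apply: inner_inj => y; rewrite -bop_adjP. Qed.

Lemma cmul_idl T : cmul I T = T. Proof. exact/bopP. Qed.
Lemma cmul_idr T : cmul T I = T. Proof. exact/bopP. Qed.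

Lemma compl_idempotent Q : is_idempotent Q -> is_idempotent (I - Q).
Proof.
rewrite /is_idempotent => QQ.
by rewrite cmulBl !cmulBr cmul_idl cmul_idr QQ cmul_idl subrr subr0.
Qed.

Lemma compl_nonproj Q : nonproj_idempotent Q -> nonproj_idempotent (I - Q).
Proof.
move=> [QQ nQ]; split; first exact: compl_idempotent.
move=> [_ sQ]; apply: nQ; split => //; move: sQ.
by rewrite cstarB cstar_id => /addrI/oppr_inj.
Qed.

(* Rescaling the two components of [a + b] to swap their norms preserves
   [|a + b|], hence the same bound controls both oblique projections. *)
Lemma rnorm_swap u v : u != 0 -> v != 0 ->
  rnorm ((rnorm v / rnorm u)%:C *: u + (rnorm u / rnorm v)%:C *: v) =
  rnorm (u + v).
Proof.
move=> u0 v0.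
have nu : 0 < rnorm u by rewrite lt_def rnorm_eq0 u0 rnorm_ge0.
have nv : 0 < rnorm v by rewrite lt_def rnorm_eq0 v0 rnorm_ge0.
apply/eqP; rewrite -(@eqrXn2 _ 2)// ?rnorm_ge0//; apply/eqP.
rewrite !rnormD_sqr !rnormZR ?divr_ge0 ?rnorm_ge0//.
rewrite !divfK ?gt_eqF// linearZl_LR linearZr_LR/=.
rewrite conj_Creal ?realE ?ler0c ?divr_ge0 ?rnorm_ge0//.
rewrite mulrA -rmorphM/= (_ : _ / _ * _ = 1) ?mul1r; last first.
  by field; rewrite !gt_eqF.
by rewrite [_ ^+ 2 + _]addrC.
Qed.

Lemma rnorm_idempotent_ge1 Q : is_idempotent Q -> Q != 0 -> 1 <= rnorm Q.
Proof.
move=> QQ Q0; have Q1 : 0 < rnorm Q by rewrite lt_def rnorm_eq0 Q0 rnorm_ge0.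
by rewrite -(ler_pM2r Q1) mul1r -{1}QQ ler_rnormM.
Qed.

(** Split [x] into [u = Q x] and [v] in the kernel of [Q]. The rescaled vector of [rnorm_swap] has
    norm [|x|], and [Q] maps it to a vector of norm [|v| = |(I - Q) x|]. *)
Lemma rnorm_compl_le Q :
  is_idempotent Q -> Q != 0 -> rnorm (I - Q) <= rnorm Q.
Proof.
move=> QQ Q0; have Q1 := rnorm_idempotent_ge1 QQ Q0.
have QQx x : Q (Q x) = Q x by rewrite -{3}QQ.
apply: rnorm_bop_le => [|x]; first exact: rnorm_ge0.
set v := (I - Q) x; set u := Q x.
have xE : x = u + v by rewrite /v bop_addE bop_oppE /= addrC subrK.
have Qu : Q u = u by exact: QQx.
have Qv : Q v = 0 by rewrite /v bop_addE bop_oppE linearB/= QQx subrr.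
have [v0|v0] := eqVneq v 0; first by rewrite v0 rnorm0 mulr_ge0 ?rnorm_ge0.
(* The rescaling divides by [|u|]. If [u = 0], then [x = v] and the claim comes from [1 <= |Q|]. *)
have [u0|u0] := eqVneq u 0.
  by rewrite xE u0 add0r ler_peMl ?rnorm_ge0.
rewrite xE -(rnorm_swap u0 v0) (le_trans _ (ler_rnorm_bop _ _))//.
rewrite linearD !linearZ/= Qu Qv scaler0 addr0.
rewrite rnormZR ?divr_ge0 ?rnorm_ge0// divfK ?rnorm_eq0//.
Qed.

Lemma nonproj_neq0 Q : nonproj_idempotent Q -> Q != 0.
Proof.
move=> [QQ nQ]; apply/eqP => Q0; apply: nQ; split=> //.
by rewrite Q0 -(scale0r (0 : bop H)) cstarZ rmorph0 !scale0r.
Qed.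

Lemma compl_compl Q : I - (I - Q) = Q.
Proof. by rewrite opprB addrC subrK. Qed.

Lemma rnorm_compl Q : nonproj_idempotent Q -> rnorm (I - Q) = rnorm Q.
Proof.
move=> npQ; have npQ' := compl_nonproj npQ.
apply/eqP; rewrite eq_le rnorm_compl_le ?nonproj_neq0//=; last by case: npQ.
rewrite -{1}[Q]compl_compl rnorm_compl_le ?nonproj_neq0//; by case: npQ'.
Qed.

(** The range and the kernel of [Q] are not orthogonal, since otherwise [Q] would be a projection.
    Gram-Schmidt is applied to a non-orthogonal pair taken from them. *)
Lemma nonproj_orthonormal Q : nonproj_idempotent Q ->
  exists u v, [/\ rnorm u = 1, rnorm v = 1 & inner u v = 0].
Proof.
move=> [QQ nQ].
have QQx x : Q (Q x) = Q x by rewrite -{3}QQ.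
have [x [y xy]] : exists x y, inner (Q x) (y - Q y) != 0.
  apply: contra_notP nQ => xy; split=> //.
  (* The right-hand side is self-adjoint, so this equality forces [cstar Q = Q]. *)
  suff sQE : cstar Q = cmul (cstar Q) Q by rewrite -[RHS]cstarK sQE cstarM cstarK.
  apply/bopP => y; apply: inner_inj => x.
  rewrite -!bop_adjP; apply/eqP; rewrite -subr_eq0 -linearBr.
  by apply: contra_notT xy => xy; exists x, y.
set a := Q x in xy; set b := y - Q y in xy.
have a0 : a != 0 by apply: contraNneq xy => ->; rewrite linear0l.
have b0 : b != 0 by apply: contraNneq xy => ->; rewrite linear0r.
have aa : inner a a != 0 by rewrite inner_norm sqrf_eq0 normr_eq0.
(* The conjugate compensates for the conjugate-linearity of [inner] in its second argument. *)
pose c := (inner a b / inner a a)^*.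
pose d := b - c *: a.
have ad : inner a d = 0.
  by rewrite linearBr/= linearZr_LR/= conjCK divfK// subrr.
(* If [b = c a], then [b] lies both in the kernel and in the range of [Q], hence vanishes. *)
have d0 : d != 0.
  apply: contraNneq b0 => /eqP; rewrite /d subr_eq0 => /eqP bca.
  have : Q b = 0 by rewrite /b linearB/= QQx subrr.
  by rewrite {1}bca linearZ/= QQx -bca => ->.
pose unit (z : H) : H := (rnorm z)^-1%:C *: z.
have rnorm_unit z : z != 0 -> rnorm (unit z) = 1.
  move=> z0; rewrite rnormZR ?invr_ge0 ?rnorm_ge0//.
  by rewrite mulVf// rnorm_eq0.
exists (unit a), (unit d); split; try exact: rnorm_unit.
by rewrite linearZl_LR linearZr_LR/= ad !mulr0.
Qed.

Fact rank1_subproof u v : (fun x => inner x v *: u) \in @bounded_op R H.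
Proof.
apply/bounded_opP; split=> [a x y|].
  by rewrite linearDl linearZl_LR scalerDl scalerA.
exists (`|v| * `|u|) => x; rewrite normrZ mulrAC ler_wpM2r// mulrC.
exact: inner_cauchy_schwarz.
Qed.
Definition rank1 u v : bop H := BOp (rank1_subproof u v).

Lemma rank1_adj u v : cstar (rank1 u v) = rank1 v u.
Proof.
apply/bopP => x; apply: inner_inj => y; rewrite -bop_adjP /=.
by rewrite linearZl_LR linearZr_LR/= -innerC mulrC.
Qed.

Lemma rnorm_inner x y : complex.Re `|inner x y| <= rnorm x * rnorm y.
Proof.
rewrite -lecR rmorphM/= -!rnormE; exact: inner_cauchy_schwarz.
Qed.

Lemma rnorm_rank1 u v : rnorm (rank1 u v) <= rnorm u * rnorm v.
Proof.
apply: rnorm_bop_le => [|x]; first by rewrite mulr_ge0 ?rnorm_ge0.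
rewrite /= rnormZ mulrC -mulrA ler_wpM2l ?rnorm_ge0// mulrC.
exact: rnorm_inner.
Qed.

End HilbertOperators.

(** * Adjoining the identity to a C*-subalgebra *)

Lemma subr_translate (V : zmodType) (a b x y z : V) :
  a - b - (y - x) = (z - y - b) - (z - x - a).
Proof.
rewrite !opprB [RHS]addrC -[RHS]addrA -[z - y - b]addrA [x - z + _]addrA subrK.
by rewrite -addrA; congr (_ + _); rewrite [LHS]addrCA [- b - y]addrC.
Qed.

Section Unitization.
Variables (R : realType) (H : hilbertType R).
Implicit Types (x y : bop H) (a b : R[i]) (S : set (bop H)).

Local Notation I := (bop_id H).

(** The sum [S + C I] formed inside [bop H]; it is direct when [I] is not in [S]. *)
Definition unitize S : set (bop H) := [set y | exists a, S (y - a *: I)].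

Lemma cmul_unitize x y a b : cmul (x + a *: I) (y + b *: I) =
  (cmul x y + (b *: x + a *: y)) + (a * b) *: I.
Proof.
rewrite cmulDl !cmulDr !cscaleAl !cscaleAr !cmul_idl !cmul_idr scalerA.
by rewrite !addrA.
Qed.

Lemma rnorm_id_le1 : rnorm I <= 1.
Proof. by apply: rnorm_bop_le => // x; rewrite mul1r. Qed.

Variable S : set (bop H).
Hypotheses (subS : cstar_subalgebra S) (S_I : ~ S I).

(** The difference of the two elements is [(b - a) I], so distinct scalars would put [I] in [S]. *)
Lemma unitize_scalar_inj y a b : S (y - a *: I) -> S (y - b *: I) -> a = b.
Proof.
move=> Sa Sb; apply/eqP; apply: contra_notT S_I => ab.
rewrite -[I](scalerK (a := b - a)) ?subr_eq0 1?eq_sym//.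
apply: subalgZ => //; have := subalgB subS Sa Sb.
by rewrite opprB addrC addrA subrK -scalerBl.
Qed.

(** As [S] is closed, [I] lies at positive distance from it; the general case follows by scaling.
    Thus the norm controls the scalar part of an element of [S + C I]. *)
Lemma dist_id_subalg :
  exists2 d, 0 < d & forall x a, S x -> complex.Re `|a| * d <= rnorm (a *: I - x).
Proof.
have [d d0 dP] : exists2 d : R, 0 < d & forall x, S x -> d <= rnorm (I - x).
  apply: contra_notP S_I => noD; apply: (subalg_limit subS) => e e0.
  apply: contra_notP noD => noS; exists e => // x Sx.
  by rewrite leNgt; apply: contra_notN noS => /ltW xe; exists x.
exists d => // x a Sx; have [->|a0] := eqVneq a 0.
  by rewrite normr0 mul0r rnorm_ge0.
rewrite -[x](scalerKV a0) -scalerBr rnormZ ler_wpM2l ?Re_normr_ge0 ?dP//.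
exact: subalgZ.
Qed.

(** Elements of [S + C I] near [z] have scalar parts near one another by [dist_id_subalg]. These
    converge, and subtracting their limit from [z] leaves a limit of elements of [S]. *)
Lemma closed_unitize (u : H) : rnorm u = 1 -> closed (unitize S).
Proof.
move=> u1; have [d d0 dP] := dist_id_subalg.
apply/closed_approxP => z zlim.
pose P e := [set w | exists a, w = a *: I /\
  exists2 x, S x & rnorm (z - x - w) <= e].
have normZI a : rnorm (a *: I) <= complex.Re `|a|.
  by rewrite rnormZ ler_piMr ?Re_normr_ge0 ?rnorm_id_le1.
(* Two members of [P e] with scalars [a] and [b] satisfy [|a - b| d <= 2 e], whence the constant
   [2 / d]. *)
have [|||w wP] := @shrinking_sets_limit R (bop H) P (2 / d).
- move=> e /zlim[y [a Sya] zy]; exists (a *: I), a; split=> //.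
  by exists (y - a *: I); rewrite // opprB addrA (addrAC _ (- y)) addrK.
- by move=> e e' ee' _ [a [-> [x Sx xe]]]; exists a; split=> //; exists x;
    rewrite // (le_trans xe).
- move=> e _ _ e0 [a [-> [x Sx xe]]] [b [-> [y Sy ye]]].
  rewrite -scalerBl (le_trans (normZI _))// mulrAC ler_pdivlMr//.
  rewrite (le_trans (dP _ (a - b) (subalgB subS Sy Sx)))//.
  rewrite scalerBl (subr_translate _ _ _ _ z).
  have := ler_rnormB (z - y - b *: I) (z - x - a *: I).
  move: (rnorm _) (rnorm _) (rnorm _) xe ye. move=> p q t; lra.
(* A limit of multiples of [I] is again one; its scalar is read off at the unit vector [u]. *)
have wZ : w = inner (w u) u *: I.
  apply/eqP; rewrite -subr_eq0; apply/eqP.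
  apply: (@rnorm_arbitrarily_small _ _ 2) => e /wP[_ [a [-> _]] wa].
  have aw : rnorm (a *: I - inner (w u) u *: I) <= e.
    rewrite -scalerBl (le_trans (normZI _))//.
    have -> : a - inner (w u) u = - inner ((w - a *: I) u) u.
      rewrite bop_addE bop_oppE bop_scaleE/= linearBl/= linearZl_LR/=.
      by rewrite -rnorm_sqr u1 expr1n mulr1 opprB.
    rewrite normrN (le_trans (rnorm_inner _ _))// u1 mulr1.
    by rewrite (le_trans (ler_rnorm_bop _ _))// u1 mulr1.
  have := ler_rdist w (a *: I) (inner (w u) u *: I).
  move: (rnorm _) (rnorm _) (rnorm _) wa aw => p q t; lra.
exists (inner (w u) u); rewrite -wZ; apply: (subalg_limit subS) => e e0.
have [|w' [a [_ [x Sx xe]]] ww'] := wP (e / 2); first by rewrite divr_gt0.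
exists x => //; have := ler_rnormD (z - x - w') (w' - w).
rewrite subrKA (rnormB w') (addrAC z (- x)).
move: (rnorm _) (rnorm _) (rnorm _) xe ww' => p q t; lra.
Qed.

Lemma unitize_subalgebra (u : H) :
  rnorm u = 1 -> cstar_subalgebra (unitize S).
Proof.
move=> u1; split.
- exact: closed_unitize u1.
- split; first by exists 0; rewrite scale0r subr0; exact: subalg0.
  move=> c x y [a Sa] [b Sb]; exists (c * a + b).
  rewrite scalerDl -scalerA opprD addrACA -scalerBr; exact: subalgP.
- move=> x y [a Sa] [b Sb]; exists (a * b).
  rewrite -[x](subrK (a *: I)) -[y](subrK (b *: I)) cmul_unitize addrK.
  apply: subalgD => //; first exact: subalgM.
  by apply: subalgD => //; exact: subalgZ.
- move=> x [a Sa]; exists (a^*).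
  by rewrite -cstar_id -cstarZ -cstarB; exact: subalg_star.
Qed.

(** Uniqueness of the scalar part makes the formula for [theta] well defined. The target is [setT]
    because multiples of [I] may lie outside [S']. *)
Lemma star_hom_unitize (S' : set (bop H)) pi : star_homomorphism S S' pi ->
  exists theta, star_homomorphism (unitize S) setT theta /\
    (forall x a, S x -> theta (x + a *: I) = pi x + a *: I).
Proof.
move=> hom_pi.
(* The default [0] only concerns [y] outside [unitize S]. *)
pose scal (y : bop H) : R[i] := xget 0 [set a | S (y - a *: I)].
have scalP y a : S (y - a *: I) -> scal y = a.
  by move=> Sya; apply: xget_unique => // b Syb; exact: unitize_scalar_inj Syb Sya.
pose theta y := pi (y - scal y *: I) + scal y *: I.
have thetaE x a : S x -> theta (x + a *: I) = pi x + a *: I.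
  by move=> Sx; rewrite /theta (@scalP _ a) addrK.
have SE y : unitize S y -> exists x a, S x /\ y = x + a *: I.
  by move=> [a Sya]; exists (y - a *: I), a; rewrite subrK.
have [_ piP piM piS] := hom_pi.
exists theta; split=> //; split => //.
- move=> c _ _ /SE[x [a [Sx ->]]] /SE[y [b [Sy ->]]].
  rewrite !thetaE// scalerDr addrACA scalerA -scalerDl thetaE; last exact: subalgP.
  by rewrite piP// scalerDr addrACA scalerA -scalerDl.
- move=> _ _ /SE[x [a [Sx ->]]] /SE[y [b [Sy ->]]].
  have Sbx := subalgZ subS b Sx; have Say := subalgZ subS a Sy.
  have SD := subalgD subS Sbx Say; have Sxy := subalgM subS Sx Sy.
  rewrite cmul_unitize !thetaE//; last exact: subalgD.
  by rewrite cmul_unitize !(star_homD hom_pi)// !(star_homZ subS hom_pi)// piM.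
- move=> _ /SE[x [a [Sx ->]]].
  have starE x' : cstar (x' + a *: I) = cstar x' + a^* *: I.
    by rewrite cstarD cstarZ cstar_id.
  by rewrite thetaE// !starE thetaE ?piS//; exact: subalg_star.
Qed.

End Unitization.

(** * Universal idempotents and their complements *)

Section UniversalIdempotent.
Variables (R : realType) (H : hilbertType R).
Implicit Types (u v : H) (Q : bop H).

Local Notation I := (bop_id H).

Section OrthonormalPair.
Variables (u v : H).
Hypotheses (u1 : rnorm u = 1) (v1 : rnorm v = 1) (uv : inner u v = 0).

(** The range is spanned by [u] and the kernel is orthogonal to [u + s v]. As [s] tends to [0], this
    tends to the projection [rank1 u u], which kills [v]. *)
Let q (s : R) : bop H := rank1 u (u + s%:C *: v).

Let uu : inner u u = 1. Proof. by rewrite -rnorm_sqr u1 expr1n. Qed.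
Let vv : inner v v = 1. Proof. by rewrite -rnorm_sqr v1 expr1n. Qed.
Let vu : inner v u = 0. Proof. by rewrite innerC uv rmorph0. Qed.

Let qu s : q s u = u.
Proof. by rewrite /= linearDr linearZr_LR/= uu uv mulr0 addr0 scale1r. Qed.

Let qv s : q s v = s%:C *: u.
Proof.
rewrite /= linearDr linearZr_LR/= vu vv mulr1 add0r.
congr (_ *: _); exact: conjc_real.
Qed.

Let sq s x : cstar (q s) x = inner x u *: (u + s%:C *: v).
Proof. by rewrite rank1_adj. Qed.

Let q_nonproj s : 0 < s -> nonproj_idempotent (q s).
Proof.
move=> s0; have qq : is_idempotent (q s).
  apply/bopP => x; rewrite -[RHS]/(inner x (u + s%:C *: v) *: u).
  by rewrite -{2}(qu s) -linearZ.
split=> // -[_ /(congr1 (fun T : bop H => T v))]; rewrite sq qv vu scale0r.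
move=> /esym/eqP; rewrite scaler_eq0 -(rnorm_eq0 u) u1 oner_eq0 orbF.
by rewrite (inj_eq (@complexI R) s 0) gt_eqF.
Qed.

Let rnorm_q s : 0 <= s -> rnorm (q s) <= 1 + s.
Proof.
move=> s0; rewrite (le_trans (rnorm_rank1 _ _))// u1 mul1r.
by rewrite (le_trans (ler_rnormD _ _))// rnormZR// u1 v1 mulr1.
Qed.

Variables (r : R) (Q : bop H).
Hypotheses (r_gt1 : 1 < r) (univQ : universal_idempotent r Q).

(** The numerator keeps [1 + s n], the bound on the norm of [q (s n)], at most [r]. *)
Let s n : R := (r - 1) / n.+1%:R.

Let s_gt0 n : 0 < s n. Proof. by rewrite divr_gt0 ?subr_gt0. Qed.

Local Notation G := (cstar_gen Q).
Let subG : cstar_subalgebra G. Proof. exact: cstar_gen_subalgebra. Qed.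

Lemma orthonormal_universal_not_id : ~ G I.
Proof.
have [_ _ univ] := univQ.
have /choice[pi piP] n : exists pi : bop H -> bop H,
    star_homomorphism G (cstar_gen (q (s n))) pi /\ pi Q = q (s n).
  apply: univ; first exact: q_nonproj.
  rewrite rnormE lecR (le_trans (rnorm_q (ltW (s_gt0 n))))//.
  by rewrite addrC -lerBrDr ler_pdivrMr// ler_peMr ?ler1n// subr_ge0 ltW.
have pi_bound n x y : G x -> rnorm (pi n x y) <= 2 * rnorm x * rnorm y.
  move=> Gx; rewrite (le_trans (ler_rnorm_bop _ _))// ler_wpM2r ?rnorm_ge0//.
  exact: (star_hom_bounded subG (piP n).1).
pose vanish x := forall e : R, 0 < e -> \forall n \near \oo, rnorm (pi n x v) <= e.
(* The bound on [pi n] is uniform in [n]: an approximation within [e / 4] costs at most [e / 2] for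
   every [n]. *)
have vanish_limit x : G x ->
    (forall e : R, 0 < e -> exists2 y, G y /\ vanish y & rnorm (x - y) <= e) ->
  vanish x.
  move=> Gx xlim e e0.
  have [|y [Gy y0] xy] := xlim (e / 4); first by rewrite divr_gt0.
  have := y0 (e / 2); rewrite divr_gt0// => /(_ isT); apply: filterS => n yn.
  have := pi_bound n _ v (subalgB subG Gx Gy).
  rewrite (star_homB (piP n).1)// v1 mulr1 bop_addE bop_oppE => xyn.
  have := ler_rnormD (pi n x v - pi n y v) (pi n y v); rewrite subrK; lra.
have vanishP a x y : G x -> G y -> vanish x -> vanish y -> vanish (a *: x + y).
  move=> Gx Gy x0 y0 e e0.
  have a1 : 0 < complex.Re `|a| + 1 by rewrite ltr_wpDl ?Re_normr_ge0.
  have e1 : 0 < e / 2 / (complex.Re `|a| + 1) by rewrite !divr_gt0.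
  have e2 : 0 < e / 2 by rewrite divr_gt0.
  apply: filterS2 (x0 _ e1) (y0 _ e2) => n xn yn.
  have [[_ piL _ _] _] := piP n; rewrite piL// bop_addE bop_scaleE.
  rewrite (le_trans (ler_rnormD _ _))// [leRHS]splitr lerD// rnormZ.
  rewrite (le_trans (ler_wpM2l (Re_normr_ge0 a) xn))//.
  by rewrite mulrCA ger_pMr// ler_pdivrMr// mul1r lerDl.
have vanishM x y : G x -> G y -> vanish y -> vanish (cmul x y).
  move=> Gx Gy y0 e e0.
  have x1 : 0 < 2 * rnorm x + 1 by rewrite ltr_wpDl// mulr_ge0 ?rnorm_ge0.
  have e1 : 0 < e / (2 * rnorm x + 1) by rewrite divr_gt0.
  apply: filterS (y0 _ e1) => n yn.
  have [[_ _ piM _] _] := piP n; rewrite piM//.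
  have x0 : 0 <= 2 * rnorm x by rewrite mulr_ge0 ?rnorm_ge0.
  rewrite (le_trans (pi_bound n x (pi n y v) Gx))//.
  rewrite (le_trans (ler_wpM2l x0 yn))//.
  by rewrite mulrCA ger_pMr// ler_pdivrMr// mul1r lerDl.
(* Vanishing elements of [G] form only a left ideal; the condition on [cstar x] gives stability
   under adjoints. *)
pose S := [set x | [/\ G x, vanish x & vanish (cstar x)]].
have subS : cstar_subalgebra S.
  split.
  - apply/closed_approxP => x xlim.
    have Gx : G x by apply: (subalg_limit subG) => e /xlim[y [Gy _ _] xy]; exists y.
    split=> //; apply: vanish_limit => //.
    + by move=> e /xlim[y [Gy y0 _] xy]; exists y.
    + exact: (subalg_star subG).
    + move=> e /xlim[y [Gy _ y0] xy]; exists (cstar y).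
        by split=> //; exact: (subalg_star subG).
      by rewrite -cstarB rnorm_star.
  - have v0 : vanish 0.
      move=> e e0; apply: nearW => n.
      by rewrite (star_hom0 subG (piP n).1) bop0E rnorm0 ltW.
    split.
      split=> //; first exact: (subalg0 subG).
      by rewrite -(scale0r (0 : bop H)) cstarZ rmorph0 !scale0r.
    move=> a x y [Gx x0 sx0] [Gy y0 sy0]; split.
    + exact: (subalgP subG).
    + exact: vanishP.
    + by rewrite cstarD cstarZ; apply: vanishP => //; exact: (subalg_star subG).
  - move=> x y [Gx x0 sx0] [Gy y0 sy0]; split.
    + exact: (subalgM subG).
    + exact: vanishM.
    + by rewrite cstarM; apply: vanishM => //; exact: (subalg_star subG).
  - by move=> x [Gx x0 sx0]; split=> //; [exact: (subalg_star subG)|rewrite cstarK].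
have GQ : G Q by exact: cstar_gen_self.
have SQ : S Q.
  split=> //.
    (* [pi n Q v = s n u] has norm [s n], which is at most [e] once [n] exceeds [(r - 1) / e]. *)
    move=> e e0; exists (Num.bound ((r - 1) / e)) => // n /= Nn.
    rewrite (piP n).2 qv rnormZR ?(ltW (s_gt0 n))// u1 mulr1.
    have re0 : 0 <= (r - 1) / e by rewrite divr_ge0 ?subr_ge0 ?(ltW r_gt1) ?(ltW e0).
    rewrite /s ler_pdivrMr// mulrC -ler_pdivrMr// ltW//.
    by rewrite (lt_le_trans (archi_boundP re0))// ler_nat leqW.
  (* The adjoint of [q (s n)] kills [v] exactly, because [inner v u = 0]. *)
  move=> e e0; apply: nearW => n; have [[_ _ _ piS] piQ] := piP n.
  by rewrite piS// piQ sq vu scale0r rnorm0 ltW.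
move=> GI; have [_ I0 _] := cstar_gen_subset subS SQ GI.
have [n In] : exists n, rnorm (pi n I v) <= 2^-1.
  have := I0 2^-1; rewrite invr_gt0 => /(_ (ltr0Sn _ _)) /filter_ex; exact.
have [[_ _ piM piS] piQ] := piP n.
have Iu : pi n I u = u.
  by rewrite -{1}(qu (s n)) -piQ -[LHS]/(cmul (pi n I) (pi n Q) u) -piM// cmul_idl piQ qu.
(* This vector is [u + s n v]. As [pi n I] fixes it and fixes [u], it fixes [v], against
   [|pi n I v| <= 1/2]. *)
have : pi n I (cstar (q (s n)) u) = cstar (q (s n)) u.
  rewrite -piQ -piS// -[LHS]/(cmul (pi n I) (pi n (cstar Q)) u) -piM ?cmul_idl//.
  exact: (subalg_star subG).
rewrite sq uu scale1r linearD/= Iu linearZ/= => /addrI.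
move=> /scalerI; rewrite (inj_eq (@complexI R) (s n) 0) gt_eqF// => /(_ isT) Iv.
by move: In; rewrite Iv v1; lra.
Qed.

End OrthonormalPair.

Lemma universal_not_id (r : R) Q :
  1 < r -> universal_idempotent r Q -> ~ cstar_gen Q I.
Proof.
move=> r1 univQ; have [npQ _ _] := univQ.
have [u [v [u1 v1 uv]]] := nonproj_orthonormal npQ.
exact: (orthonormal_universal_not_id u1 v1 uv r1 univQ).
Qed.

Lemma universal_compl (r : R) Q :
  1 < r -> universal_idempotent r Q -> universal_idempotent r (I - Q).
Proof.
move=> r1 univQ; have [npQ nQ univ] := univQ.
have npQ' := compl_nonproj npQ.
have nQ' : `|I - Q| = r%:C by rewrite rnormE rnorm_compl// -rnormE.
have subG := cstar_gen_subalgebra Q.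
have GI := universal_not_id r1 univQ.
have [u [v [u1 _ _]]] := nonproj_orthonormal npQ.
have subT := unitize_subalgebra subG GI u1.
(* The complement has norm [r], so it is an admissible target for the universality of [Q] itself. *)
have [|pi [hom_pi piQ]] := univ _ _ npQ'; first by rewrite nQ'.
have [theta [hom_theta thetaE]] := star_hom_unitize subG GI hom_pi.
have [_ thetaP thetaM thetaS] := hom_theta.
have TQ : unitize (cstar_gen Q) (I - Q).
  exists 1; rewrite scale1r addrC addKr -scaleN1r.
  by apply: (subalgZ subG); exact: cstar_gen_self.
have thetaQ : theta (I - Q) = Q.
  have GQ : cstar_gen Q Q by exact: cstar_gen_self.
  rewrite addrC -[I in theta (_ + I)]scale1r thetaE; last first.
    by rewrite -scaleN1r; exact: (subalgZ subG).
  by rewrite scale1r -scaleN1r (star_homZ subG hom_pi)// piQ scaleN1r addrC compl_compl.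
(* Once [S] is known to be a C*-subalgebra containing [I - Q], it contains all of
   [cstar_gen (I - Q)], so [theta] maps that algebra into [cstar_gen Q]. *)
pose S := [set y | unitize (cstar_gen Q) y /\ cstar_gen Q (theta y)].
have subS : cstar_subalgebra S.
  split.
  - apply/closed_approxP => y ylim.
    have Ty : unitize (cstar_gen Q) y.
      by apply: (subalg_limit subT) => e /ylim[z [Tz _] yz]; exists z.
    split=> //; apply: (subalg_limit subG) => e e0.
    (* Halving [e] absorbs the factor [2] of [star_hom_bounded]. *)
    have [|z [Tz Gz] yz] := ylim (e / 2); first by rewrite divr_gt0.
    exists (theta z) => //; rewrite -(star_homB hom_theta)//.
    have := star_hom_bounded subT hom_theta (subalgB subT Ty Tz).
    by move=> le2; lra.
  - split.
      by split; [exact: (subalg0 subT)|rewrite (star_hom0 subT hom_theta); exact: (subalg0 subG)].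
    move=> a x y [Tx Gx] [Ty Gy]; split; first exact: (subalgP subT).
    by rewrite thetaP//; exact: (subalgP subG).
  - move=> x y [Tx Gx] [Ty Gy]; split; first exact: (subalgM subT).
    by rewrite thetaM//; exact: (subalgM subG).
  - move=> x [Tx Gx]; split; first exact: (subalg_star subT).
    by rewrite thetaS//; exact: (subalg_star subG).
have genS : cstar_gen (I - Q) `<=` S.
  apply: cstar_gen_subset => //; split=> //.
  by rewrite thetaQ; exact: cstar_gen_self.
split=> // B Q' npB nB.
have [rho [[rhoG rhoP rhoM rhoS] rhoQ]] := univ B Q' npB nB.
exists (rho \o theta); split; last by rewrite /= thetaQ.
split=> /=.
- by move=> x /genS[_ /rhoG].
- by move=> a x y /genS[Tx Gx] /genS[Ty Gy]; rewrite thetaP// rhoP.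
- by move=> x y /genS[Tx Gx] /genS[Ty Gy]; rewrite thetaM// rhoM.
- by move=> x /genS[Tx Gx]; rewrite thetaS// rhoS.
Qed.

End UniversalIdempotent.

Theorem corollary3p15 (R : realType) (r : R) (H : hilbertType R) (Q : bop H)
    (r_gt1 : 1 < r) (H_neq0 : exists x : H, x != 0)
    (Q_nonproj : nonproj_idempotent Q) :
  universal_idempotent r Q <-> universal_idempotent r (bop_id H - Q).
Proof.
split; first exact: universal_compl.
by move=> /(universal_compl r_gt1); rewrite compl_compl.
Qed.
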